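(* Let $p$ be an odd prime, $\Bbbk$ a field of characteristic $p$, $G=\langle\sigma\rangle$ a cyclic group of order $p$, $V=V_3$ and $1\le n\le p$. Then $$T_{n-1}=\{\Delta^{n-1}(M_{n-1})\}\cup\{\Delta^{p-1}(P_i): 0\le i<n,\ i\text{ odd or zero}\}$$ is a minimal generating set of $I^G_{n-1}=\Bbbk[V]^G\cap\operatorname{im}(\Delta^{n-1})$ as a module over $A=\Bbbk[a_1,a_2,a_3]$.
   Context: $V_3$ is the indecomposable $\Bbbk G$-module of dimension $3$; $\Bbbk[V]=S(V^* )=\Bbbk[x_1,x_2,x_3]$ with $\sigma$ acting by algebra automorphisms, $\sigma x_1=x_1+x_2$, $\sigma x_2=x_2+x_3$, $\sigma x_3=x_3$. $\Delta=\sigma-1$ acting on $\Bbbk[V]$, and $\operatorname{im}(\Delta^{n-1})$ is its image in $\Bbbk[V]$ (for $n=p$, $\Delta^{p-1}=\sum_{i=0}^{p-1}\sigma^i$ is the transfer and $I^G_{p-1}$ is the transfer ideal). $A$ is the subalgebra of $\Bbbk[V]^G$ generated by $a_1=x_3$, $a_2=x_2^2-2x_1x_3-x_2x_3$, $a_3=\prod_{i=0}^{p-1}\sigma^i(x_1)$. $M_i=x_1^{i/2}$ if $i$ is even and $M_i=x_1^{(i-1)/2}x_2$ if $i$ is odd; $P_0=x_1^{p-1}x_2$ and $P_i=x_1^{p-(i+1)/2}$ if $i$ is odd. A minimal generating set is a generating set no proper subset of which generates. *)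

(* Defs.v *)
From HB Require Import structures.
From mathcomp Require Import all_boot all_order all_algebra.
From mathcomp Require Import all_fingroup all_solvable all_field all_character.
From mathcomp.multinomials Require Import mpoly.

Set Implicit Arguments.
Unset Strict Implicit.
Unset Printing Implicit Defensive.

Import GRing.Theory.
Local Open Scope ring_scope.

Definition x1 (k : fieldType) : {mpoly k[3]} := 'X_(Ordinal (isT : (0 < 3)%N)).
Definition x2 (k : fieldType) : {mpoly k[3]} := 'X_(Ordinal (isT : (1 < 3)%N)).
Definition x3 (k : fieldType) : {mpoly k[3]} := 'X_(Ordinal (isT : (2 < 3)%N)).

(* The single 3 x 3 unipotent Jordan block, rows indexed from 0.  As the matrix
   of sigma on V^* in the basis x_1, x_2, x_3 (row i being the coordinates of
   sigma x_i), it makes V^*, hence V, the indecomposable module V_3. *)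
Definition jordan3 (k : fieldType) : 'M[k]_3 :=
  \matrix_(i < 3, j < 3) ((j == i :> nat) || (j == i.+1 :> nat))%:R.

Section Action.
Variables (k : fieldType) (gT : finGroupType) (G : {group gT}).

(* The action on k[V] = S(V^* ) by algebra automorphisms extending the
   representation rG on V^*, whose basis x_1, x_2, x_3 is acted upon through row
   vectors.  It is a right action; G is abelian below, so the side is
   immaterial. *)
Definition act (rG : mx_representation k G 3) (g : gT) (f : {mpoly k[3]}) :
    {mpoly k[3]} :=
  f \mPo [tuple \sum_(j < 3) rG g i j *: 'X_j | i < 3].

Definition invariant (rG : mx_representation k G 3) (f : {mpoly k[3]}) : Prop :=
  forall g, g \in G -> act rG g f = f.

Definition Delta (rG : mx_representation k G 3) (s : gT) (f : {mpoly k[3]}) :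
    {mpoly k[3]} :=
  act rG s f - f.

Definition imDelta (rG : mx_representation k G 3) (s : gT) (m : nat)
    (f : {mpoly k[3]}) : Prop :=
  exists h, f = iter m (Delta rG s) h.

Definition IG (rG : mx_representation k G 3) (s : gT) (m : nat)
    (f : {mpoly k[3]}) : Prop :=
  invariant rG f /\ imDelta rG s m f.

Definition a1 : {mpoly k[3]} := x3 k.
Definition a2 : {mpoly k[3]} := x2 k ^+ 2 - 2%:R * x1 k * x3 k - x2 k * x3 k.
Definition a3 (rG : mx_representation k G 3) (s : gT) (p : nat) :
    {mpoly k[3]} :=
  \prod_(i < p) act rG (s ^+ i)%g (x1 k).

Definition inA (rG : mx_representation k G 3) (s : gT) (p : nat)
    (f : {mpoly k[3]}) : Prop :=
  exists q : {mpoly k[3]}, f = q \mPo [tuple a1; a2; a3 rG s p].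

End Action.

Definition M (k : fieldType) (i : nat) : {mpoly k[3]} :=
  if odd i then x1 k ^+ i.-1./2 * x2 k else x1 k ^+ i./2.

(* Only used for i odd or zero. *)
Definition P (k : fieldType) (p i : nat) : {mpoly k[3]} :=
  if i == 0%N then x1 k ^+ p.-1 * x2 k else x1 k ^+ (p - i.+1./2)%N.

(* T rG s p m is the set T_m; its second part ranges over 0 <= i < m + 1. *)
Definition T (k : fieldType) (gT : finGroupType) (G : {group gT})
    (rG : mx_representation k G 3) (s : gT) (p m : nat) (f : {mpoly k[3]}) :
    Prop :=
  f = iter m (Delta rG s) (M k m) \/
  exists i : nat, [/\ (i < m.+1)%N, odd i \/ i = 0%N
                    & f = iter p.-1 (Delta rG s) (P k p i)].

Section Generation.
Variable R : nzRingType.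
Implicit Types A S I : R -> Prop.

Definition module_span A S (f : R) : Prop :=
  exists (r : nat) (c b : 'I_r -> R),
    [/\ forall j, A (c j), forall j, S (b j) & f = \sum_(j < r) c j * b j].

Definition generates A S I : Prop := forall f, I f <-> module_span A S f.

Definition proper_sub S S' : Prop :=
  (forall f, S f -> S' f) /\ exists f, S' f /\ ~ S f.

Definition minimal_generating_set A S I : Prop :=
  generates A S I /\ forall S', proper_sub S' S -> ~ generates A S' I.

End Generation.

Section Sanity.
Variables (k : fieldType) (gT : finGroupType) (s : gT).

Lemma act_sigma (rG : mx_representation k <[s]> 3) :
  rG s = jordan3 k ->
  [/\ act rG s (x1 k) = x1 k + x2 k, act rG s (x2 k) = x2 k + x3 k
    & act rG s (x3 k) = x3 k].
Proof.
move=> rGs; split; rewrite /act comp_mpolyXU -tnth_nth tnth_mktuple;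
  rewrite !big_ord_recl big_ord0 rGs !mxE /= ?scale1r ?scale0r ?add0r ?addr0;
  by do ?congr (_ + _); congr ('X_(_)); apply: val_inj.
Qed.

Lemma jordan3_exp_char (p : nat) :
  p \in [pchar k] -> odd p -> jordan3 k ^+ p = 1.
Proof.
move=> chp oddp; set N := jordan3 k - 1.
have chM : p \in [pchar 'M[k]_3] by rewrite pchar_lalg.
have N3 : N ^+ 3 = 0.
  apply/matrixP=> i j; rewrite !exprS expr0 mulr1 !mxE.
  rewrite !big_ord_recl big_ord0 !mxE !big_ord_recl !big_ord0 !mxE.
  by case: i => [[|[|[|//]]] ?]; case: j => [[|[|[|//]]] ?];
    rewrite /= ?subrr ?subr0 ?(mul0r, mulr0, addr0, add0r, mul1r).
have p3 : (3 <= p)%N.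
  by have := prime_gt1 (pcharf_prime chp); case: (p) oddp => [|[|[|]]].
have -> : jordan3 k = N + 1 by rewrite subrK.
rewrite -(pFrobenius_autE chM) pFrobenius_autD_comm; last exact: commr1.
by rewrite pFrobenius_aut1 pFrobenius_autE -(subnK p3) exprD N3 mulr0 add0r.
Qed.

Lemma V3_exists (p : nat) :
  p \in [pchar k] -> odd p -> #[s]%g = p ->
  exists rG : mx_representation k <[s]> 3, rG s = jordan3 k.
Proof.
move=> chp oddp os; have Jp := jordan3_exp_char chp oddp.
have p1 := prime_gt1 (pcharf_prime chp).
have Jmod m : jordan3 k ^+ (m %% p) = jordan3 k ^+ m.
  by rewrite [in RHS](divn_eq m p) exprD mulnC exprM Jp expr1n mul1r.
pose ex (g : gT) := if [pick i : 'I_p | g == (s ^+ i)%g] is Some i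
  then (i : nat) else 0%N.
have exE m : ex (s ^+ m)%g = (m %% p)%N.
  rewrite /ex; case: pickP => [i | /(_ (Ordinal (ltn_pmod m (ltnW p1))))] /=.
    by rewrite eq_expg_mod_order os => /eqP ->; rewrite modn_small.
  by rewrite -os expg_mod_order eqxx.
have rP : mx_repr <[s]>%G (fun g => jordan3 k ^+ ex g).
  split=> [|_ _ /cycleP[i ->] /cycleP[j ->]].
    by rewrite -(expg0 s) exE mod0n expr0.
  by rewrite -expgD !exE !Jmod exprD.
exists (MxRepresentation rP) => /=.
by rewrite -[in ex s](expg1 s) exE Jmod expr1.
Qed.

End Sanity.

(* Main.v *)
Require Import Defs.
From HB Require Import structures.
From mathcomp Require Import all_boot all_order all_algebra.
From mathcomp Require Import all_fingroup all_solvable all_field all_character.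
From mathcomp.multinomials Require Import mpoly.
From mathcomp Require Import ring zify.

(** Setting [x_3 = 1] embeds each homogeneous component of [k[V]] in
    [k[alpha][y]], with [y = x_2] and [alpha = y^2 - y - 2 x_1], where sigma
    becomes the substitution [y := y + 1], [a_2] becomes [alpha], and
    invariants are controlled by their degree in [y].  Write [m = (p-1)/2] and
    [r = uphalf n] for the level [n < p], i.e. for the n-th power of Delta.

    - [Delta^n (M_n)] is a nonzero multiple of [a_1^r], and for [l < m] the
      transfer of [x_1^(p-1-l)] is a polynomial in [a_1, a_2] with lowest term
      in [a_1] equal to a nonzero multiple of [a_1^l a_2^(m-l)].  Hence the
      A-span of [T_n] contains [a_1^l a_2^j a_3^c] as soon as [r <= l] or
      [m <= l + j], as well as all [a_1^l a_2^j a_3^c Q], where [Q] is the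
      transfer of [P_0].  These elements are linearly independent: the degree
      of [a_3^c Q^e] in [y] is [p (2c + e)].
    - In a fixed degree [d] the dimensions of [ker Delta /\ im Delta^n], summed
      over [n < p], add up to the dimension ['C(d+2, 2)] of [k[V]_d], because
      [Delta^p = 0].  The independent elements above are already that many, so
      they span these intersections.
    - Minimality is read off from single coefficients, except for [Q], which
      is not in [A] because elements of [A] have degree in [y] divisible by
      [2p]. *)

Set Implicit Arguments.
Unset Strict Implicit.
Unset Printing Implicit Defensive.

Import GRing.Theory.
Local Open Scope ring_scope.

(** * The difference operator on polynomials *)

Section PolyShift.
Variable S : comNzRingType.
Implicit Types f g : {poly S}.

Definition pdelta f := f \Po ('X + 1) - f.

Lemma pdelta_is_linear : linear pdelta.
Proof.
by move=> c f g; rewrite /pdelta comp_polyD comp_polyZ scalerBr addrACA opprD.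
Qed.
HB.instance Definition _ :=
  GRing.isLinear.Build S {poly S} {poly S} _ pdelta pdelta_is_linear.

Lemma pdeltaC c : pdelta c%:P = 0.
Proof. by rewrite /pdelta comp_polyC subrr. Qed.

(** [N] is only a bound on the degree, so the coefficient of index [N] may vanish. The induction
    peels off a factor ['X], whose shift contributes the extra summand [f]. *)
Lemma pdelta_lead N f : (size f <= N.+1)%N ->
  (size (pdelta f) <= N)%N /\ (pdelta f)`_N.-1 = f`_N *+ N.
Proof.
elim/poly_ind: f N => [|f c IHf] N.
  by move=> _; rewrite linear0 size_poly0 !coef0 mul0rn.
rewrite size_MXaddC; case: ifP => [/andP[]|_].
  move=> /eqP -> /eqP -> _.
  by rewrite mul0r add0r pdeltaC size_poly0 !coef0 mul0rn.
have -> : pdelta (f * 'X + c%:P) = pdelta f * 'X + (pdelta f + f).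
  by rewrite /pdelta comp_poly_MXaddC; ring.
case: N => [|N] //=; first by rewrite ltnS leqn0 size_poly_eq0 => /eqP->;
  rewrite !(linear0, mul0r, add0r) size_poly0 !coef0.
rewrite ltnS => /[dup] sf /IHf [szd cd]; split.
  rewrite (leq_trans (size_polyD _ _)) // geq_max; apply/andP; split.
    by rewrite (leq_trans (size_polyMleq _ _)) // size_polyX addn2.
  rewrite (leq_trans (size_polyD _ _)) // geq_max sf andbT.
  exact: leq_trans szd _.
rewrite coefD coefMX cd [X in _ + X]coefD (nth_default _ szd) add0r
  [in RHS]coefD coefMX /=.
by rewrite coefC addr0 mulrSr; case: (N) => //=; rewrite mulr0n.
Qed.

Lemma iter_pdelta_lead N j f : (j <= N)%N -> (size f <= N.+1)%N ->
  (size (iter j pdelta f) <= (N - j).+1)%N /\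
  (iter j pdelta f)`_(N - j) = f`_N *+ (N ^_ j).
Proof.
elim: j => [|j IHj] jN sf; first by rewrite subn0 /= ffactn0.
have [sj cj] := IHj (ltnW jN) sf.
have [] := pdelta_lead sj; rewrite iterS => s1 c1.
by rewrite subnSK // subnS c1 cj -mulrnA ffactnSr.
Qed.

Lemma iter_pdelta_const N f : (size f <= N.+1)%N ->
  iter N pdelta f = (f`_N *+ N`!)%:P.
Proof.
move=> sf; have [] := iter_pdelta_lead (leqnn N) sf.
by rewrite subnn ffactnn => /size1_polyC -> <-; rewrite coefC.
Qed.

Lemma iter_pdeltaZ i c f : iter i pdelta (c *: f) = c *: iter i pdelta f.
Proof. by elim: i => //= i ->; rewrite linearZ. Qed.

Lemma iter_pdelta_sum i n (F : 'I_n -> {poly S}) :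
  iter i pdelta (\sum_j F j) = \sum_j iter i pdelta (F j).
Proof. by elim: i => //= i ->; rewrite linear_sum. Qed.

End PolyShift.

Lemma map_pdelta (S S' : comNzRingType) (h : {rmorphism S -> S'}) (f : {poly S}) :
  map_poly h (pdelta f) = pdelta (map_poly h f).
Proof. by rewrite /pdelta rmorphB /= map_comp_poly rmorphD /= map_polyX rmorph1. Qed.

Lemma map_iter_pdelta (S S' : comNzRingType) (h : {rmorphism S -> S'}) i f :
  map_poly h (iter i (@pdelta S) f) = iter i (@pdelta S') (map_poly h f).
Proof. by elim: i => //= i <-; rewrite map_pdelta. Qed.

Lemma natf_neq0_ltp (S : idomainType) p i : p \in [pchar S] ->
  (0 < i < p)%N -> i%:R != 0 :> S.
Proof.
move=> cp /andP[i0 ip]; rewrite -(dvdn_pcharf cp); apply/negP => /(dvdn_leq i0).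
by rewrite leqNgt ip.
Qed.

Lemma natf_ffact_neq0 (S : idomainType) p N j : p \in [pchar S] ->
  (forall i, (i < j)%N -> ~~ (p %| N - i)%N) -> (N ^_ j)%:R != 0 :> S.
Proof.
move=> cp; elim: j => [|j IHj] H; first by rewrite ffactn0 oner_eq0.
rewrite ffactnSr natrM mulf_neq0 //; last by rewrite -(dvdn_pcharf cp) H.
by apply: IHj => i ij; apply: H; apply: ltnW.
Qed.

Lemma natf_fact_neq0 (S : idomainType) p N : p \in [pchar S] ->
  (N < p)%N -> N`!%:R != 0 :> S.
Proof.
move=> cp Np; rewrite -ffactnn (natf_ffact_neq0 cp) // => i iN.
by rewrite gtnNdvd; lia.
Qed.

(** In degree [e] with [0 < e < p], the difference has the leading coefficient times [e] in degree
    [e - 1], and [e] is nonzero in [S]. The bound is sharp, as ['X^p - 'X] is killed. *)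
Lemma pdelta_ker (S : idomainType) p (f : {poly S}) : p \in [pchar S] ->
  (size f <= p)%N -> pdelta f = 0 -> (size f <= 1)%N.
Proof.
move=> cp sf df; rewrite leqNgt; apply/negP => s1.
have f0 : f != 0 by rewrite -size_poly_gt0 (ltn_trans _ s1).
have [] := @pdelta_lead _ (size f).-1 f _; first by rewrite prednK // ltnW.
rewrite df coef0 => _ /esym/eqP; rewrite -mulr_natr mulf_eq0 lead_coef_eq0.
have fp : (0 < (size f).-1 < p)%N by lia.
by rewrite (negPf f0) (negPf (natf_neq0_ltp cp fp)).
Qed.

Lemma rmorph_mpoly_ext n (R : comNzRingType) (S : nzRingType)
    (f g : {rmorphism {mpoly R[n]} -> S}) :
  (forall c, f c%:MP = g c%:MP) -> (forall i, f 'X_i = g 'X_i) -> f =1 g.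
Proof.
move=> fgC fgX q; rewrite (mpolyE q) !rmorph_sum; apply: eq_bigr => m _.
rewrite -mul_mpolyC !rmorphM /= fgC mpolyXE_id; congr (_ * _).
by rewrite !rmorph_prod; apply: eq_bigr => i _; rewrite !rmorphXn fgX.
Qed.

(** * Dehomogenization *)

Section Dehomogenization.
Variable k : fieldType.
Hypothesis two_neq0 : 2%:R != 0 :> k.

(** The equation [alpha = y^2 - y - 2 x_1] solved for [x_1]; the outer ['X] is [y] and ['X%:P] is
    [alpha]. *)
Definition dehom_x1 : {poly {poly k}} :=
  (2%:R^-1)%:P%:P * ('X^2 - 'X - 'X%:P).

Definition dehom : {mpoly k[3]} -> {poly {poly k}} :=
  mmap (polyC \o polyC) (fun i : 'I_3 => [:: dehom_x1; 'X; 1]`_i).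
HB.instance Definition _ := GRing.RMorphism.on dehom.

Lemma dehomC c : dehom c%:MP = c%:P%:P.
Proof. exact: mmapC. Qed.

Lemma dehomB f g : dehom (f - g) = dehom f - dehom g.
Proof. exact: mmapB. Qed.

Lemma dehomM f g : dehom (f * g) = dehom f * dehom g.
Proof. exact: rmorphM. Qed.

Lemma dehomXn f i : dehom (f ^+ i) = dehom f ^+ i.
Proof. exact: rmorphXn. Qed.

Lemma dehomZ c f : dehom (c *: f) = c%:P%:P * dehom f.
Proof. exact: mmapZ. Qed.

Lemma dehomX i : dehom 'X_i = [:: dehom_x1; 'X; 1]`_i.
Proof. by rewrite /dehom mmapX mmap1U. Qed.

Lemma dehom_x1E : dehom (x1 k) = dehom_x1. Proof. exact: dehomX. Qed.
Lemma dehom_x2E : dehom (x2 k) = 'X. Proof. exact: dehomX. Qed.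
Lemma dehom_x3E : dehom (x3 k) = 1. Proof. exact: dehomX. Qed.

Lemma dehom_a1 : dehom (a1 k) = 1. Proof. exact: dehomX. Qed.

Lemma double_dehom_x1 : 2%:R * dehom_x1 = 'X^2 - 'X - 'X%:P.
Proof.
rewrite /dehom_x1 mulrA -[X in X * _](_ : (2%:R * 2%:R^-1)%:P%:P = _).
  by rewrite divff // mul1r.
by rewrite !rmorphM /= !rmorph_nat.
Qed.

Lemma dehom_a2 : dehom (a2 k) = 'X%:P.
Proof.
rewrite /a2 !(rmorphB, rmorphM, rmorphXn, rmorph_nat) /=.
by rewrite dehom_x1E dehom_x2E dehom_x3E !mulr1 double_dehom_x1; ring.
Qed.

Lemma dehom_x1_shift : dehom_x1 \Po ('X + 1) = dehom_x1 + 'X.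
Proof.
have half : (2%:R^-1)%:P%:P * 2%:R = 1 :> {poly {poly k}}.
  by rewrite -(rmorph_nat (polyC \o polyC)) /= -!rmorphM /= mulVf.
rewrite /dehom_x1 rmorphM !rmorphB /= rmorphXn /= comp_polyX !comp_polyC.
move: (_^-1%:P%:P) half => c half.
by rewrite -[X in _ = _ + X]mul1r -[X in _ = _ + X * _]half; ring.
Qed.

(** The change of variables is invertible, so [f] vanishes at [x_3 = 1]; in a fixed degree a
    monomial is determined by its exponents of [x_1] and [x_2], so nothing can cancel there. *)
Lemma dehom_homog_inj d f : f \is d.-homog -> dehom f = 0 -> f = 0.
Proof.
(* [A] is [alpha] in terms of [x_1] and [x_2], and [h2] substitutes it back. *)
move=> hf f0; set A := x2 k ^+ 2 - x2 k - 2%:R * x1 k.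
pose h1 : {rmorphism {poly k} -> {mpoly k[3]}} :=
  horner_morph (fun c => mulrC A (@mpolyC 3 k c)).
pose h2 : {rmorphism {poly {poly k}} -> {mpoly k[3]}} :=
  horner_morph (fun c => mulrC (x2 k) (h1 c)).
have h2C c : h2 c%:P%:P = c%:MP.
  by rewrite /h2 /= horner_morphC /h1 /= horner_morphC.
have hX : h2 'X = x2 k by exact: horner_morphX.
have hA : h2 'X%:P = A by rewrite /h2 /= horner_morphC /h1 /= horner_morphX.
have : f \mPo [tuple x1 k; x2 k; 1] = 0.
  rewrite -(rmorph0 h2) -f0; symmetry.
  apply: (@rmorph_mpoly_ext 3 k _ (h2 \o dehom) (comp_mpoly _)) => [c|i] /=.
    by rewrite dehomC h2C comp_mpolyC.
  rewrite dehomX comp_mpolyXU.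
  case: i => [[|[|[|//]]] ?] /=; rewrite ?rmorph1 //.
  rewrite /dehom_x1 rmorphM !rmorphB h2C rmorphXn /= hX hA /A.
  transitivity ((2%:R^-1)%:MP * 2%:R * x1 k : {mpoly k[3]}); first by ring.
  by rewrite -(rmorph_nat (@mpolyC 3 k)) -rmorphM /= mulVf // mpolyC1 mul1r.
move=> fE; apply/mpolyP => m; rewrite mcoeff0.
have [md|md] := eqVneq (mdeg m) d; last exact: dhomog_nemf_coeff hf md.
pose i0 := Ordinal (isT : (0 < 3)%N); pose i1 := Ordinal (isT : (1 < 3)%N).
pose i2 := Ordinal (isT : (2 < 3)%N).
(* [t m] is what the monomial [m] becomes at [x_3 = 1]. *)
pose t (m : 'X_{1..3}) := (U_(i0) *+ m i0 + U_(i1) *+ m i1)%MM.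
have deg3 (m' : 'X_{1..3}) : mdeg m' = (m' i0 + m' i1 + m' i2)%N.
  rewrite mdegE !big_ord_recl big_ord0 addn0 addnA.
  by do 2?congr (_ + _)%N; congr (m' _); apply: val_inj.
move: (congr1 (mcoeff (t m)) fE); rewrite mcoeff0 comp_mpolyEX raddf_sum /=.
have E (m' : 'X_{1..3}) : m' \in msupp f ->
  (f@_m' *: ('X_[m'] \mPo [tuple x1 k; x2 k; 1]))@_(t m)
     = (m' == m)%:R * f@_m'.
  move=> /(dhomogP _ _ _ hf) /=; rewrite -md !deg3 => m'd.
  rewrite mcoeffZ mulrC; congr (_ * _).
  rewrite comp_mpolyX !big_ord_recl big_ord0 /= !(tnth_nth 0) /= expr1n !mulr1.
  have -> : lift ord0 ord0 = i1 :> 'I_3 by exact: val_inj.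
  have -> : ord0 = i0 :> 'I_3 by exact: val_inj.
  rewrite /x1 /x2 !mpolyXn -mpolyXD mcoeffX; congr (_%:R : k).
  congr nat_of_bool; apply/eqP/eqP => [/mnmP tE | -> //].
  move: (tE i0) (tE i1); rewrite /t !(mnmDE, mulmnE, mnm1E) /= => e0 e1.
  apply/mnmP; case=> [[|[|[|//]]]] lt3.
  - by rewrite [Ordinal _](_ : _ = i0); [lia | exact: val_inj].
  - by rewrite [Ordinal _](_ : _ = i1); [lia | exact: val_inj].
  - by rewrite [Ordinal _](_ : _ = i2); [lia | exact: val_inj].
rewrite (eq_big_seq _ E).
have [mf|/memN_msupp_eq0 -> //] := boolP (m \in msupp f).
rewrite (bigD1_seq m) ?msupp_uniq //= eqxx mul1r big1 ?addr0 // => m' /negPf ->.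
by rewrite mul0r.
Qed.

End Dehomogenization.

(** * The action of the group and of Delta *)

Section ActionTheory.
Local Notation act := Defs.act.
Variables (k : fieldType) (gT : finGroupType) (G : {group gT}).
Variable rG : mx_representation k G 3.
Implicit Types (g h : gT) (f : {mpoly k[3]}).

Lemma act_is_linear g : linear (act rG g).
Proof. by move=> c f h; rewrite /Defs.act linearP. Qed.
HB.instance Definition _ g :=
  GRing.isLinear.Build k {mpoly k[3]} {mpoly k[3]} _ (act rG g) (act_is_linear g).

Lemma act_is_monoid_morphism g : monoid_morphism (act rG g).
Proof. by split=> [|f h]; rewrite /Defs.act (rmorph1, rmorphM). Qed.
HB.instance Definition _ g :=
  GRing.isMonoidMorphism.Build {mpoly k[3]} {mpoly k[3]} (act rG g)
    (act_is_monoid_morphism g).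

Lemma actX g (i : 'I_3) : act rG g 'X_i = \sum_(j < 3) rG g i j *: 'X_j.
Proof. by rewrite /act comp_mpolyXU -tnth_nth tnth_mktuple. Qed.

Lemma actC g c : act rG g c%:MP = c%:MP.
Proof. exact: comp_mpolyC. Qed.

Lemma act1 f : act rG 1%g f = f.
Proof.
apply: (@rmorph_mpoly_ext 3 k _ (act rG 1%g) idfun) => [c|i] /=; first exact: actC.
rewrite actX repr_mx1 (bigD1 i) //= mxE eqxx scale1r big1 ?addr0 // => j.
by rewrite eq_sym mxE => /negPf ->; rewrite scale0r.
Qed.

Lemma actM g h f : g \in G -> h \in G ->
  act rG (g * h)%g f = act rG h (act rG g f).
Proof.
move=> gG hG.
apply: (@rmorph_mpoly_ext 3 k _ (act rG (g * h)%g) (act rG h \o act rG g)) => [c|i] /=.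
  by rewrite !actC.
rewrite !actX repr_mxM // linear_sum /=.
rewrite (eq_bigr (fun j => \sum_(l < 3) (rG g i l * rG h l j) *: 'X_j)); last first.
  by move=> j _; rewrite mxE scaler_suml.
rewrite exchange_big /=; apply: eq_bigr => l _.
by rewrite linearZ /= actX scaler_sumr; apply: eq_bigr => j _; rewrite scalerA.
Qed.

Lemma actX_exp s i f : s \in G -> act rG (s ^+ i)%g f = iter i (act rG s) f.
Proof.
by move=> sG; elim: i => [|i IHi]; rewrite ?act1 // expgSr actM ?groupX // IHi.
Qed.

Lemma act_homog g d f : f \is d.-homog -> act rG g f \is d.-homog.
Proof.
move=> hf; rewrite (mpolyE f) linear_sum /= big_seq rpred_sum // => m mf.
rewrite linearZ /= rpredZ // -(dhomogP _ _ _ hf m mf) mpolyXE_id.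
rewrite /= mdegE rmorph_prod /=.
elim/big_rec2: _ => [|i e q _ IH]; first exact: dhomog1.
rewrite dhomogM // -[X in X.-homog]mul1n rmorphXn dhomogMn //= actX.
by apply: rpred_sum => j _; rewrite rpredZ // dhomogX /= mdeg1.
Qed.

(** The action preserves the grading, so invariants and preimages can later be replaced by their
    homogeneous components. *)
Lemma pihomog_act g d f :
  pihomog mdeg d (act rG g f) = act rG g (pihomog mdeg d f).
Proof.
elim/mpolyind: f => [|c m f _ _ IHf]; first by rewrite !linear0.
rewrite (linearP (act rG g)) !(linearP (pihomog mdeg d)).
rewrite (linearP (act rG g)) /= IHf; congr (c *: _ + _).
have hm : ('X_[m] : {mpoly k[3]}) \is (mdeg m).-homog by rewrite dhomogX.
have [<-|md] := eqVneq (mdeg m) d.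
  by rewrite !pihomog_dE //; apply: act_homog.
by rewrite !(pihomog_ne0 md) ?linear0 //; apply: act_homog.
Qed.

Variable s : gT.
Local Notation D := (Delta rG s).

Lemma Delta_is_linear : linear D.
Proof. by move=> c f g; rewrite /Delta linearP /= scalerBr addrACA opprD. Qed.
HB.instance Definition _ :=
  GRing.isLinear.Build k {mpoly k[3]} {mpoly k[3]} _ D Delta_is_linear.

Lemma iter_Delta_is_linear i : linear (iter i D).
Proof. by move=> c f g; elim: i => //= i ->; rewrite linearP. Qed.
HB.instance Definition _ i :=
  GRing.isLinear.Build k {mpoly k[3]} {mpoly k[3]} _ (iter i D)
    (iter_Delta_is_linear i).

Lemma iter_Delta_homog i d f : f \is d.-homog -> iter i D f \is d.-homog.
Proof. by move=> hf; elim: i => //= i IHi; rewrite rpredB // act_homog. Qed.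

Lemma pihomog_iter_Delta i d f :
  pihomog mdeg d (iter i D f) = iter i D (pihomog mdeg d f).
Proof. by elim: i => //= i IHi; rewrite linearB /= pihomog_act IHi. Qed.

Lemma iter_Delta_mull i c f :
  D c = 0 -> iter i D (c * f) = c * iter i D f.
Proof.
move/subr0_eq => ac; elim: i => //= i ->.
by rewrite {1}/Delta rmorphM /= ac -mulrBr.
Qed.

Lemma DeltaM_eq0 c f : D c = 0 -> D f = 0 -> D (c * f) = 0.
Proof. by move=> c0 f0; have /= -> := iter_Delta_mull 1 f c0; rewrite f0 mulr0. Qed.

Lemma Delta1_eq0 : D 1 = 0. Proof. by rewrite /Delta rmorph1 subrr. Qed.

Lemma DeltaX_eq0 c i : D c = 0 -> D (c ^+ i) = 0.
Proof.
move=> c0; elim: i => [|i IHi]; first by rewrite expr0 Delta1_eq0.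
by rewrite exprS DeltaM_eq0.
Qed.

Lemma iter_DeltaE i f :
  iter i D f =
    \sum_(j < i.+1) (((-1) ^+ (i - j) * 'C(i, j)%:R) *: iter j (act rG s) f).
Proof.
elim: i => [|i IHi]; first by rewrite big_ord1 /= bin0 mulr1 scale1r.
rewrite iterS IHi {1}/Delta linear_sum /=.
rewrite [X in X - _]big_ord_recr [X in _ - X]big_ord_recl [RHS]big_ord_recr.
rewrite [in RHS]big_ord_recl /= !subnn !bin0 !binn !mulr1 !subn0.
(* Pascal's rule, with [bump 0 j] standing for [j + 1]. *)
have E (j : 'I_i) : ((-1) ^+ (i.+1 - bump 0 j) * 'C(i.+1, bump 0 j)%:R) *:
      act rG s (iter (0 + j) (act rG s) f) =
    act rG s (((-1) ^+ (i - j) * 'C(i, j)%:R) *: iter j (act rG s) f) -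
    ((-1) ^+ (i - bump 0 j) * 'C(i, bump 0 j)%:R) *:
      act rG s (iter (0 + j) (act rG s) f) :> {mpoly k[3]}.
  rewrite linearZ /= /bump /= !add0n -scalerBl subSS binS natrD add1n.
  by congr (_ *: _); rewrite -(subnSK (ltn_ord j)) exprS; ring.
rewrite (eq_bigr _ (fun j _ => E j)) sumrB exprS mulN1r scaleNr.
by rewrite linearZ /= !expr0 !scale1r; ring.
Qed.

(** [(sigma - 1)^p = sigma^p - 1 = 0]: the inner binomial coefficients vanish in characteristic [p],
    and the sign [(-1)^p] is [-1]. *)
Lemma Delta_order p f : p \in [pchar k] -> odd p -> s \in G -> #[s]%g = p ->
  iter p D f = 0.
Proof.
move=> cp oddp sG os; rewrite iter_DeltaE.
have pp := pcharf_prime cp; have p0 := prime_gt0 pp.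
case: p p0 => // q _ in cp oddp os pp *.
rewrite big_ord_recr big_ord_recl /= subnn binn bin0 subn0 mulr1 expr0 mulr1.
rewrite big1 ?addr0; last first.
  move=> j _; rewrite (_ : _%:R = 0) ?mulr0 ?scale0r //.
  apply/eqP; rewrite -(dvdn_pcharf cp) prime_dvd_bin //.
  by rewrite /bump /= add1n ltnS ltn_ord.
have -> : act rG s (iter q (act rG s) f) = f.
  by rewrite -iterS -actX_exp // -os expg_order act1.
by rewrite -signr_odd oddp expr1 scaleN1r scale1r addNr.
Qed.
End ActionTheory.

(** * Dimensions of the socle filtration *)

Section NilpotentFiltration.
Variables (K : fieldType) (V : vectType K) (f : 'End(V)).

Definition iter_img n : {vspace V} := iter n (fun U => f @: U)%VS fullv.

Lemma iter_imgP n v : reflect (exists w, v = iter n f w) (v \in iter_img n).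
Proof.
apply: (iffP idP) => [|[w ->]]; last first.
  by elim: n => [|n IHn]; rewrite ?memvf // /iter_img !iterS memv_img.
elim: n v => [|n IHn] v; first by exists v.
by case/memv_imgP => u /IHn[w ->] ->; exists w.
Qed.

(* The sum over n of the dimensions of [ker f :&: im f^n] telescopes to the
   dimension of [V], so it can only be attained by the full intersections. *)
Lemma nilpotent_filtration_eq p (L : 'I_p -> {vspace V}) :
  (forall n : 'I_p, (L n <= iter_img n :&: lker f)%VS) -> iter_img p = 0%VS ->
  (\dim {:V} <= \sum_(n < p) \dim (L n))%N ->
  forall n : 'I_p, L n = (iter_img n :&: lker f)%VS.
Proof.
move=> LI Ip dimL.
(* Rank-nullity for [f] restricted to [iter_img q], whose image is [iter_img q.+1]. *)
have tele q : (\sum_(n < q) \dim (iter_img n :&: lker f) + \dim (iter_img q)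
    = \dim {:V})%N.
  elim: q => [|q IHq]; first by rewrite big_ord0.
  by rewrite big_ord_recr -IHq -[in RHS](limg_ker_dim f (iter_img q)) /= addnA.
have := leqif_sum (fun n (_ : true) => dimv_leqif_eq (LI n)).
have := tele p; rewrite Ip dimv0 addn0 => -> [_].
rewrite eqn_leq dimL andbT => eqL n.
have : (\sum_(n < p) \dim (L n) <= \dim {:V})%N.
  by rewrite -(tele p) Ip dimv0 addn0; apply: leq_sum => i _; apply: dimvS.
by rewrite eqL => /forallP/(_ n)/implyP/(_ isT)/eqP.
Qed.

End NilpotentFiltration.

Lemma dim_span_family (K : fieldType) (V : vectType K) (I : finType)
    (A : pred I) (b : I -> V) :
  (forall c : I -> K, \sum_(i in A) c i *: b i = 0 -> forall i, i \in A -> c i = 0) ->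
  \dim <<[seq b i | i <- enum A]>> = #|A|.
Proof.
move=> indep; pose X := [tuple of [seq b i | i <- enum_tuple A]].
have -> : [seq b i | i <- enum A] = X by [].
suff : free X by rewrite /free size_tuple => /eqP.
have Xi (i : 'I_#|A|) : X`_i = b (enum_val i).
  by rewrite (nth_map (enum_default i)) -?cardE.
apply/freeP => c cX i; have iA := enum_valP i.
have := indep (fun x => c (enum_rank_in iA x)); rewrite big_enum_val /=.
under eq_bigr do rewrite enum_valK_in -Xi.
by move=> /(_ cX _ iA); rewrite enum_valK_in.
Qed.

(** * Counting the independent family in a fixed degree *)

Section Counting.
Variable p : nat.
Hypotheses (p_odd : odd p) (p_gt1 : (1 < p)%N).
Local Notation m := (p./2).

(* The number of [n < p] for which [a_1^(d - 2j) a_2^j] lies in the image of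
   the n-th power of Delta. *)
Definition socle_mult d j := if (m <= d - j)%N then p else (d - j.*2).*2.+1.

Lemma sum_socle_mult_low d : (d < p)%N ->
  (\sum_(j < d./2.+1) socle_mult d j = 'C(d.+2, 2))%N.
Proof.
move=> dp; have pm : p = m.*2.+1 by rewrite -[LHS]odd_double_half p_odd.
(* The closed form is that of the uncapped terms [2(d - 2j) + 1]. The terms with [j <= d - m] are
   capped to [p], but at [t = d - m] both sums equal [(t + 1)p], so the form holds from there on;
   [d < p] rules out the first alternative at [t = d./2]. *)
suff H t : (t <= d./2)%N -> (m + t < d \/ 
   \sum_(j < t.+1) socle_mult d j + 2 * t.+1 * t = t.+1 * d.*2.+1)%N.
  have [|] := H _ (leqnn _); first by lia.
  have := mul_bin_left d.+2 1; rewrite bin1 /= => C.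
  by have := odd_double_half d; case: (odd d) => /= dE; nia.
have sumP t' : (m + t' <= d)%N ->
    (\sum_(j < t'.+1) socle_mult d j = t'.+1 * p)%N.
  move=> td; rewrite (eq_bigr (fun=> p)) ?sum_nat_const ?card_ord // => j _.
  by rewrite /socle_mult ifT //; have := ltn_ord j; lia.
elim: t => [|t IHt] td.
  have [?|dm] := ltnP (m + 0) d; [by left|right].
  by rewrite big_ord_recl big_ord0 /socle_mult /=; case: ifP => ?; nia.
have [?|dm] := ltnP (m + t.+1) d; [by left|right].
have [e|ne] := eqVneq (m + t.+1)%N d; first by rewrite sumP ?e //; nia.
have [|IH] := IHt (ltnW td); first by lia.
rewrite big_ord_recr /= {2}/socle_mult ifF; last by lia.
have [e de] : exists e, d = (t.+1.*2 + e)%N by exists (d - t.+1.*2)%N; lia.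
have -> : (d - t.+1.*2 = e)%N by lia.
by move: (\sum_(j < _) _)%N IH => S; rewrite de; clear; nia.
Qed.

(* The pair [(e, j)] stands for [a_1^l a_2^j a_3^(e./2) Q^(odd e)], where [Q] is
   the transfer of [P_0] and [l] is fixed by the total degree [d]. *)
Definition family_pred d n (x : 'I_d.+2 * 'I_d.+1) :=
  (x.2.*2 + p * uphalf x.1 <= d)%N &&
  [|| odd x.1, uphalf n <= d - x.2.*2 - p * uphalf x.1
    | m <= d - x.2 - p * uphalf x.1]%N.

Arguments family_pred : clear implicits.

(** With [o = odd e] and [c = uphalf e], the number of levels [n < p] at which the pair [(e, j)]
    belongs to the family. *)
Let term o d c j := (\sum_(n < p) ((j.*2 + p * c <= d) &&
  [|| o, uphalf n <= d - j.*2 - p * c | m <= d - j - p * c]))%N.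

Lemma termE o d c j : term o d c j =
  if (j.*2 + p * c <= d)%N then (if o then p else socle_mult (d - p * c) j) else 0%N.
Proof.
rewrite /term; case: ifP => _; last by rewrite big1.
case: o => /=; first by rewrite sum_nat_const card_ord muln1.
have -> : (d - j - p * c = d - p * c - j)%N by lia.
have -> : (d - j.*2 - p * c = d - p * c - j.*2)%N by lia.
move: (d - p * c)%N => d'; rewrite /socle_mult.
case: leqP => mj.
  by under eq_bigr do rewrite orbT; rewrite sum_nat_const card_ord muln1.
under eq_bigr do rewrite orbF.
(* [uphalf n <= b] means [n <= 2b]; for [q = p] the minimum is the second argument, because
   [d' - j < m]. *)
have H q : (\sum_(n < q) (uphalf n <= d' - j.*2) = minn q (d' - j.*2).*2.+1)%N.
  elim: q => [|q IHq]; first by rewrite big_ord0 min0n.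
  by rewrite big_ord_recr IHq /=; case: leqP; lia.
by rewrite H; have := odd_double_half p; rewrite p_odd; lia.
Qed.

Let total E d := (\sum_(e < E) \sum_(j < d.+1) term (odd e) d (uphalf e) j)%N.

Lemma sum_term_bound (F : nat -> nat) q d : (q <= d)%N ->
  (\sum_(j < d.+1) (if j.*2 <= q then F j else 0) = \sum_(j < q./2.+1) F j)%N.
Proof.
move=> qd; rewrite (big_ord_widen d.+1 F); last by lia.
rewrite [RHS]big_mkcond; apply: eq_bigr => j _.
by congr (if _ then _ else _); lia.
Qed.

(* Dividing by [a_3] lowers [e] by 2 and the degree [d] by [p]. *)
Lemma total_rec E d : total E.+2 d =
  (\sum_(j < d.+1) term false d 0 j + (\sum_(j < d.+1) term true d 1 j +
   \sum_(e < E) \sum_(j < d.+1) term (odd e) d (uphalf e).+1 j))%N.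
Proof.
rewrite /total big_ord_recl [X in (_ + X)%N]big_ord_recl.
congr (_ + (_ + _))%N; apply: eq_bigr => e _.
by apply: eq_bigr => j _; rewrite /bump /= add0n negbK.
Qed.

Lemma term_shift o d c j : (p <= d)%N -> term o d c.+1 j = term o (d - p) c j.
Proof.
move=> pd; rewrite !termE mulnS subnDA; congr (if _ then _ else _); lia.
Qed.

(** Induction on [d] in steps of [p]. For [d >= p] all [a_1, a_2] monomials of degree [d] count [p]
    times, as do their analogues of degree [d - p] times [Q]; the rest is [total] in degree [d - p].
    The bound on [E] ensures that no [e] is missed. *)
Lemma totalE E d : (d.+2 <= E)%N -> total E d = 'C(d.+2, 2).
Proof.
have pm : p = m.*2.+1 by rewrite -[LHS]odd_double_half p_odd.
elim/ltn_ind: d E => d IHd [|[|E]] //; rewrite !ltnS => dE.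
rewrite total_rec.
have -> : (\sum_(j < d.+1) term false d 0 j = \sum_(j < d./2.+1) socle_mult d j)%N.
  under eq_bigr do rewrite termE muln0 addn0 subn0.
  by rewrite sum_term_bound.
have [dp|pd] := ltnP d p.
  rewrite sum_socle_mult_low // !big1 ?addn0 // => [e _|j _].
    rewrite big1 // => j _; rewrite termE ifF //; apply/negbTE.
    by rewrite -ltnNge mulnS; move: (p * _)%N => w; lia.
  by rewrite termE ifF //; lia.
have -> : (\sum_(j < d.+1) term true d 1 j = (d - p)./2.+1 * p)%N.
  under eq_bigr do rewrite (term_shift _ _ _ pd) termE muln0 addn0.
  by rewrite (sum_term_bound (fun=> p)) ?leq_subr // sum_nat_const card_ord.
have -> : (\sum_(e < E) \sum_(j < d.+1) term (odd e) d (uphalf e).+1 j =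
    total E (d - p))%N.
  rewrite /total; apply: eq_bigr => e _.
  rewrite (big_ord_widen d.+1 (term (odd e) (d - p) (uphalf e))) ?ltnS ?leq_subr //.
  rewrite [RHS]big_mkcond; apply: eq_bigr => j _; rewrite (term_shift _ _ _ pd).
  by case: ifP => // jd; rewrite termE ifF //; move: jd (p * _)%N; lia.
have -> : (\sum_(j < d./2.+1) socle_mult d j = d./2.+1 * p)%N.
  rewrite (eq_bigr (fun=> p)) ?sum_nat_const ?card_ord // => j _.
  by rewrite /socle_mult ifT //; have := ltn_ord j; lia.
rewrite IHd; first last.
- lia.
- lia.
have := mul_bin_left d.+2 1; have := mul_bin_left (d - p).+2 1; rewrite !bin1 /=.
have [q ->] : exists q, d = (p + q)%N by exists (d - p)%N; lia.
rewrite addKn => C1 C2.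
(* As [p] is odd, exactly one of the two halvings rounds down; both sides of the recursion then
   differ from ['C(q + 2, 2)] by [p (m + q + 2)]. *)
have : ((p + q)./2 + q./2 = m + q)%N by lia.
nia.
Qed.

Lemma sum_card_family d :
  (\sum_(n < p) #|family_pred d n| = 'C(d.+2, 2))%N.
Proof.
have cardP n : #|family_pred d n| =
    (\sum_(e < d.+2) \sum_(j < d.+1) family_pred d n (e, j))%N.
  rewrite pair_bigA -sum1_card big_mkcond; apply: eq_bigr => -[e j] _ /=.
  by rewrite -[_ \in _]/(family_pred d n (e, j)); case: (family_pred d n (e, j)).
rewrite -(totalE (leqnn _)) /total; under eq_bigr do rewrite cardP.
by rewrite exchange_big; apply: eq_bigr => e _; rewrite exchange_big.
Qed.

End Counting.
Arguments family_pred : clear implicits.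

(** * Spans and coefficients *)

Section ModuleSpan.
Variables (R : comNzRingType) (A S : R -> Prop).
Hypotheses (A1 : A 1) (AM : forall c c', A c -> A c' -> A (c * c')).

Lemma module_span0 : module_span A S 0.
Proof. by exists 0%N, (fun=> 0), (fun=> 0); split=> [[]|[]|] //; rewrite big_ord0. Qed.

Lemma module_spanD f g :
  module_span A S f -> module_span A S g -> module_span A S (f + g).
Proof.
move=> [r [c [b [Ac Sb ->]]]] [r' [c' [b' [Ac' Sb' ->]]]].
pose glue (u : 'I_r -> R) (u' : 'I_r' -> R) (i : 'I_(r + r')) :=
  match split i with inl j => u j | inr j => u' j end.
exists (r + r')%N, (glue c c'), (glue b b'); split=> [i|i|].
- by rewrite /glue; case: split.
- by rewrite /glue; case: split.
rewrite big_split_ord /glue; congr (_ + _); apply: eq_bigr => i _.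
  by rewrite (unsplitK (inl i)).
by rewrite (unsplitK (inr i)).
Qed.

Lemma module_spanM a f : A a -> module_span A S f -> module_span A S (a * f).
Proof.
move=> Aa [r [c [b [Ac Sb ->]]]]; exists r, (fun i => a * c i), b; split=> // [i|].
  exact: AM.
by rewrite mulr_sumr; apply: eq_bigr => i _; rewrite mulrA.
Qed.

Lemma module_span_gen f : S f -> module_span A S f.
Proof.
by move=> Sf; exists 1%N, (fun=> 1), (fun=> f); split=> //; rewrite big_ord1 mul1r.
Qed.

Lemma module_span_sum (I : Type) (s : seq I) (P : pred I) (F : I -> R) :
  (forall i, P i -> module_span A S (F i)) ->
  module_span A S (\sum_(i <- s | P i) F i).
Proof.
move=> HF; elim/big_rec: _ => [|i f Pi Sf]; first exact: module_span0.
exact/module_spanD/Sf/HF.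
Qed.

Lemma module_span_ind (J : R -> Prop) f :
  J 0 -> (forall g h, J g -> J h -> J (g + h)) ->
  (forall c b, A c -> S b -> J (c * b)) -> module_span A S f -> J f.
Proof.
move=> J0 JD JM [r [c [b [Ac Sb ->]]]].
by elim/big_rec: _ => // i g _ Jg; apply: JD => //; apply: JM.
Qed.

End ModuleSpan.

(** The last polynomial has the largest degree, so its leading coefficient cannot cancel; its
    multiplier vanishes and the sum shortens. *)
Lemma distinct_size_free (S : idomainType) E (z : nat -> {poly S}) (q : nat -> S) :
  (forall i j, (i < j)%N -> (size (z i) < size (z j))%N) ->
  (forall i, z i != 0) -> \sum_(e < E) q e *: z e = 0 ->
  forall e, (e < E)%N -> q e = 0.
Proof.
move=> zlt z0; elim: E => // E IHE; rewrite big_ord_recr /= => sum0.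
have qE : q E = 0.
  have := congr1 (coefp (size (z E)).-1) sum0; rewrite /= coef0 coefD coef_sum.
  rewrite big1 ?add0r => [|i _].
    by rewrite coefZ => /eqP; rewrite mulf_eq0 lead_coef_eq0 (negPf (z0 E)) orbF => /eqP.
  rewrite coefZ nth_default ?mulr0 // -ltnS prednK ?size_poly_gt0 //.
  exact/zlt/ltn_ord.
move=> e; rewrite ltnS leq_eqVlt => /predU1P[-> //|]; apply: IHE.
by move: sum0; rewrite qE scale0r addr0.
Qed.

Section MpolyCoef.
Variables (n : nat) (R : comNzRingType).

(** This criterion by degree and the next one by the exponent of one variable serve to exclude
    monomials in the minimality proofs. *)
Lemma mcoeff_mul_homog d (c b : {mpoly R[n]}) (mu : 'X_{1..n}) :
  b \is d.-homog -> (mdeg mu < d)%N -> (c * b)@_mu = 0.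
Proof.
move=> hb mud; rewrite mcoeffM big1 // => -[m1 m2] /= /eqP mE.
rewrite (dhomog_nemf_coeff hb) ?mulr0 //.
by apply/eqP => m2d; have := congr1 (@mdeg n) mE; rewrite mdegD m2d; lia.
Qed.

Lemma mcoeff_mul_Xn (c : {mpoly R[n]}) i e (mu : 'X_{1..n}) :
  (mu i < e)%N -> (c * 'X_i ^+ e)@_mu = 0.
Proof.
move=> mue; rewrite mcoeffM big1 // => -[m1 m2] /= /eqP mE.
rewrite mpolyXn mcoeffX; case: eqP => [m2E|_]; last by rewrite mulr0.
have := congr1 (fun m : 'X_{1..n} => m i) mE.
by rewrite /= -m2E mnmDE mulmnE mnm1E eqxx; lia.
Qed.

End MpolyCoef.

(** * The generators of the image of Delta^n *)

Section TransferGenerators.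
Local Notation act := Defs.act.
Variables (p : nat) (k : fieldType).
Hypotheses (p_odd : odd p) (k_char : p \in [pchar k]).
Variables (gT : finGroupType) (s : gT).
Hypothesis s_order : #[s]%g = p.
Variable rG : mx_representation k <[s]> 3.
Hypothesis rG_sigma : rG s = jordan3 k.

Local Notation D := (Delta rG s).
Local Notation m := (p./2).

Lemma p_double : p = m.*2.+1.
Proof. by rewrite -[LHS]odd_double_half p_odd. Qed.

Lemma p_gt2 : (2 < p)%N.
Proof.
by have := prime_gt1 (pcharf_prime k_char); move: p_odd; case: (p) => [|[|[|]]].
Qed.

Lemma two_neq0 : 2%:R != 0 :> k.
Proof. by apply: (natf_neq0_ltp k_char); rewrite p_gt2. Qed.

Let half_neq0 : 2%:R^-1 != 0 :> k.
Proof. by rewrite invr_eq0 two_neq0. Qed.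

Lemma dehom_act f : dehom (act rG s f) = dehom f \Po ('X + 1).
Proof.
have [s1 s2 s3] := act_sigma rG_sigma.
apply: (@rmorph_mpoly_ext 3 k _ (@dehom k \o act rG s)
  (comp_poly ('X + 1) \o @dehom k)) => [c|i] /=.
  by rewrite actC !dehomC comp_polyC.
case: i => [[|[|[|//]]] i3].
- rewrite (_ : 'X_ _ = x1 k); last by congr ('X_(_)); apply: val_inj.
  by rewrite s1 rmorphD /= dehom_x1E dehom_x2E dehom_x1_shift ?two_neq0.
- rewrite (_ : 'X_ _ = x2 k); last by congr ('X_(_)); apply: val_inj.
  by rewrite s2 rmorphD /= dehom_x2E dehom_x3E comp_polyX.
- rewrite (_ : 'X_ _ = x3 k); last by congr ('X_(_)); apply: val_inj.
  by rewrite s3 dehom_x3E comp_polyC.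
Qed.

Lemma dehom_iter_Delta i f : dehom (iter i D f) = iter i (@pdelta _) (dehom f).
Proof.
by elim: i => //= i <-; rewrite /pdelta -dehom_act {1}/Delta dehomB.
Qed.

Lemma Delta_p f : iter p D f = 0.
Proof. by apply: Delta_order => //; apply: cycle_id. Qed.

Lemma invariantP f : Defs.invariant rG f <-> D f = 0.
Proof.
split=> [/(_ s (cycle_id s)) sf|/subr0_eq sf _ /cycleP[i ->]].
  by rewrite /Delta sf subrr.
by rewrite actX_exp ?cycle_id //; elim: i => //= i ->.
Qed.

Lemma dehom_monomial_lead a b :
  size (dehom (x1 k ^+ a * x2 k ^+ b)) = (a.*2 + b).+1 /\
  (dehom (x1 k ^+ a * x2 k ^+ b))`_(a.*2 + b) = (2%:R^-1 ^+ a)%:P.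
Proof.
have l0 : lead_coef ('X^2 - 'X - 'X%:P : {poly {poly k}}) = 1.
  rewrite -addrA lead_coefDl ?lead_coefXn // size_polyXn -opprD size_polyN.
  by rewrite size_XaddC.
have s0 : size ('X^2 - 'X - 'X%:P : {poly {poly k}}) = 3.
  rewrite -addrA size_polyDl ?size_polyXn // -opprD size_polyN.
  by rewrite size_XaddC.
have s1 : size (dehom_x1 k) = 3.
  by rewrite /dehom_x1 mul_polyC size_scale // polyC_eq0.
have l1 : lead_coef (dehom_x1 k) = (2%:R^-1)%:P.
  by rewrite /dehom_x1 mul_polyC lead_coefZ l0 mulr1.
have nz : dehom_x1 k != 0 by rewrite -size_poly_gt0 s1.
have sE : size (dehom (x1 k ^+ a * x2 k ^+ b)) = (a.*2 + b).+1.
  rewrite rmorphM !rmorphXn /= dehom_x1E dehom_x2E size_Mmonic ?monicXn //.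
    rewrite size_polyXn addnS /= -[size (dehom_x1 k ^+ a)]prednK ?size_exp ?s1; first lia.
    by rewrite size_poly_gt0 expf_neq0.
  exact: expf_neq0.
split=> //; rewrite (_ : (a.*2 + b)%N = (size (dehom (x1 k ^+ a * x2 k ^+ b))).-1).
  rewrite -lead_coefE rmorphM !rmorphXn /= dehom_x1E dehom_x2E lead_coefM.
  by rewrite lead_coefXn mulr1 lead_coef_exp l1 -polyC_exp.
by rewrite sE.
Qed.

Lemma x1_homog : x1 k \is 1.-homog. Proof. by rewrite dhomogX /= mdeg1. Qed.
Lemma x2_homog : x2 k \is 1.-homog. Proof. by rewrite dhomogX /= mdeg1. Qed.
Lemma x3_homog : x3 k \is 1.-homog. Proof. by rewrite dhomogX /= mdeg1. Qed.

Lemma a2_homog : a2 k \is 2.-homog.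
Proof.
rewrite /a2 -mulrA mulr_natl !rpredB ?rpredMn // ?(dhomogMn 2 x2_homog) //.
  exact: (dhomogM x1_homog x3_homog).
exact: (dhomogM x2_homog x3_homog).
Qed.

Lemma a3_homog : a3 rG s p \is p.-homog.
Proof.
rewrite /a3 -[X in X.-homog](card_ord p) -sum1_card.
elim/big_rec2: _ => [|i e q _ IH]; first exact: dhomog1.
by rewrite dhomogM // act_homog // x1_homog.
Qed.

Lemma Delta_a1 : D (a1 k) = 0.
Proof. by have [_ _ s3] := act_sigma rG_sigma; rewrite /Delta s3 subrr. Qed.

Lemma Delta_a2 : D (a2 k) = 0.
Proof.
have [s1 s2 s3] := act_sigma rG_sigma.
rewrite /Delta /a2 !(rmorphB, rmorphM, rmorphXn, rmorph_nat) /= s1 s2 s3.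
by ring.
Qed.

(** Sigma permutes the factors cyclically, the last going to the first since [sigma^p = 1]. *)
Lemma Delta_a3 : D (a3 rG s p) = 0.
Proof.
apply/eqP; rewrite /Delta subr_eq0 /a3 rmorph_prod /=; apply/eqP.
have E i : act rG s (act rG (s ^+ i)%g (x1 k)) = act rG (s ^+ i.+1)%g (x1 k).
  by rewrite !actX_exp ?cycle_id.
under eq_bigr do rewrite E.
case: p s_order => [|q] sq; first by rewrite !big_ord0.
rewrite big_ord_recr big_ord_recl /= -sq expg_order expg0 mulrC.
by congr (_ * _).
Qed.

Lemma dehom_a3_size : size (dehom (a3 rG s p)) = (p.*2).+1.
Proof.
have sz i : size (dehom (act rG (s ^+ i)%g (x1 k))) = 3.
  rewrite actX_exp ?cycle_id //; elim: i => [|i IHi] /=.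
    by have [] := dehom_monomial_lead 1 0; rewrite expr0 mulr1 expr1.
  by rewrite dehom_act size_comp_poly2 // size_XaddC.
rewrite /a3 rmorph_prod /= size_prod => [|i _]; last first.
  by rewrite -size_poly_gt0 sz.
by under eq_bigr do rewrite sz; rewrite sum_nat_const card_ord; lia.
Qed.

Lemma M_monomial i : M k i = x1 k ^+ i./2 * x2 k ^+ odd i.
Proof.
rewrite /M; case: ifP => [oi|_]; last by rewrite expr0 mulr1.
rewrite expr1; congr (_ ^+ _ * _); move: oi; case: i => //= i.
by rewrite uphalf_half => /negPf ->.
Qed.

Lemma exp1_homog f i : f \is 1.-homog -> (f ^+ i : {mpoly k[3]}) \is i.-homog.
Proof. by move=> hf; rewrite -[X in X.-homog]mul1n dhomogMn. Qed.

Lemma M_homog i : M k i \is (uphalf i).-homog.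
Proof.
rewrite M_monomial uphalf_half addnC.
by rewrite dhomogM ?exp1_homog ?x1_homog ?x2_homog.
Qed.

(** [M_i] has degree exactly [i] in [y], so its [i]-th difference is the constant [i!] times its
    leading coefficient, nonzero for [i < p]; the degree of [M_i] fixes the power of [x_3]. *)
Lemma iter_Delta_M i : (i < p)%N ->
  exists2 u : k, u != 0 & iter i D (M k i) = u *: a1 k ^+ uphalf i.
Proof.
move=> ip; exists (2%:R^-1 ^+ i./2 * i`!%:R).
  by rewrite mulf_neq0 ?expf_neq0 // (natf_fact_neq0 k_char ip).
apply/eqP; rewrite -subr_eq0; apply/eqP.
apply: (@dehom_homog_inj k two_neq0 (uphalf i)).
  rewrite rpredB ?rpredZ ?iter_Delta_homog ?M_homog //.
  by rewrite exp1_homog ?x3_homog.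
rewrite dehomB dehomZ rmorphXn /= dehom_x3E expr1n mulr1 dehom_iter_Delta.
rewrite M_monomial; have [] := dehom_monomial_lead i./2 (odd i).
rewrite addnC odd_double_half => sz cf.
rewrite (@iter_pdelta_const _ i) ?sz // cf -[X in X%:P - _]mulr_natr.
by rewrite -polyC_natr -polyCM subrr.
Qed.

Definition transfer_P0 := iter p.-1 D (P k p 0).

Lemma transfer_P0_homog : transfer_P0 \is p.-homog.
Proof.
rewrite /transfer_P0 iter_Delta_homog // /P /=.
have -> : (x1 k ^+ p.-1 * x2 k \is p.-homog) =
    (x1 k ^+ p.-1 * x2 k \is (p.-1 + 1).-homog).
  by rewrite addn1 (prednK (ltnW (ltnW p_gt2))).
by rewrite dhomogM ?x2_homog ?exp1_homog ?x1_homog.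
Qed.

(** [P_0] has degree [2p - 1] in [y], and [p - 1] differences multiply its leading coefficient by
    [(2p - 1) ... (p + 1)], which has no factor divisible by [p]. *)
Lemma transfer_P0_size : size (dehom transfer_P0) = p.+1.
Proof.
rewrite /transfer_P0 dehom_iter_Delta /P /= -[x2 k]expr1.
have [sz cf] := dehom_monomial_lead p.-1 1; set F := dehom _ in sz cf *.
have [] := @iter_pdelta_lead _ (p.-1.*2 + 1) p.-1 F _ _; rewrite ?sz //; first lia.
have -> : (p.-1.*2 + 1 - p.-1)%N = p by have := p_gt2; lia.
rewrite cf => sz' cf'; apply/eqP; rewrite eqn_leq sz' /= ltnNge.
apply/negP => /(nth_default 0) /eqP; rewrite cf' -[X in X == _]mulr_natr mulf_eq0.
rewrite polyC_eq0 expf_eq0 (negPf half_neq0) andbF /=; apply/negP.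
rewrite -(rmorph_nat (@polyC k)) polyC_eq0 (natf_ffact_neq0 k_char) // => i ip.
rewrite (_ : (_ - i)%N = (p + (p.-1 - i))%N); last lia.
by rewrite dvdn_addr // gtnNdvd; have := p_gt2; lia.
Qed.

Lemma Delta_transfer f : D (iter p.-1 D f) = 0.
Proof. by rewrite -iterS prednK ?Delta_p // (ltnW (ltnW p_gt2)). Qed.

(** * Transfers of powers of [x_1] *)

Section TransferX1.
Let g : {poly k} := 'X^2 - 'X.

Let size_g : size g = 3.
Proof. by rewrite /g size_polyDl ?size_polyXn // size_polyN size_polyX. Qed.

Let g_monic : g \is monic.
Proof.
by rewrite monicE /g lead_coefDl ?lead_coefXn // size_polyN size_polyX size_polyXn.
Qed.

Let size_gX j : size (g ^+ j) = j.*2.+1.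
Proof.
rewrite -(prednK (_ : 0 < size (g ^+ j))%N) ?size_exp ?size_g ?mul2n //.
by rewrite size_poly_gt0 monic_neq0 // rpredX.
Qed.

Let dehom_g : map_poly polyC g = dehom (x2 k ^+ 2 - x2 k).
Proof. by rewrite dehomB rmorphXn /= dehom_x2E /g rmorphB /= map_polyXn map_polyX. Qed.

(** For [j <= m] the degree [2j] is at most [p - 1]. Otherwise the result has degree below [p] and
    its difference vanishes because [Delta^p = 0], so [pdelta_ker] applies. *)
Lemma iter_pdelta_g_const j : (j < p)%N ->
  (size (iter p.-1 (@pdelta _) (g ^+ j)) <= 1)%N.
Proof.
move=> jp; have p0 : (0 < p)%N by lia.
have [jm|mj] := leqP j m.
  rewrite (@iter_pdelta_const _ p.-1) ?size_polyC ?leq_b1 //.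
  by rewrite size_gX; have := p_double; lia.
apply: (@pdelta_ker _ p) => //.
  have [] := @iter_pdelta_lead _ j.*2 p.-1 (g ^+ j) _ _; rewrite ?size_gX //.
    by have := p_double; lia.
  by move=> sz _; apply: leq_trans sz _; lia.
rewrite -iterS prednK //; apply: (map_inj_poly (@polyC_inj k)); first exact: polyC0.
rewrite map_iter_pdelta rmorphXn /= dehom_g -rmorphXn.
by rewrite -dehom_iter_Delta Delta_p // rmorph0 map_poly0.
Qed.

(* Expanding [(y^2 - y - alpha)^N], the summand [alpha^i (y^2 - y)^(N - i)] is
   killed by [Delta^(p-1)] if [i > m - l], and otherwise mapped to a multiple of
   [alpha^i], nonzero for [i = m - l]. *)
Lemma transfer_x1 l : (l < m)%N ->
  exists2 e : nat -> k, e (m - l)%N != 0 &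
    iter p.-1 D (x1 k ^+ (p.-1 - l)) =
      \sum_(i < (m - l).+1) e i *: (a1 k ^+ (p.-1 - l - i.*2) * a2 k ^+ i).
Proof.
move=> lm; have pm := p_double.
set N := (p.-1 - l)%N; set b := (m - l)%N; pose h : k := 2%:R^-1.
have Np : (N < p)%N by rewrite /N; lia.
have bN : (b <= N)%N by rewrite /N /b; lia.
pose F i := iter p.-1 (@pdelta _) (g ^+ (N - i)).
pose e i : k := h ^+ N * (-1) ^+ i * 'C(N, i)%:R * (F i)`_0.
have FC i : F i = ((F i)`_0)%:P by apply/size1_polyC/iter_pdelta_g_const; lia.
exists e.
  (* At [i = b] one has [N - b = m], so [F b] is the constant [(p - 1)!]; the binomial coefficient
     divides [N!] with [N < p]. *)
  rewrite /e !mulf_neq0 ?expf_neq0 ?oppr_eq0 ?oner_eq0 //.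
    have := natf_fact_neq0 k_char Np.
    by rewrite -(bin_fact bN) natrM mulf_eq0 negb_or => /andP[].
  have Nb : (p.-1 = (N - b).*2)%N by rewrite /N /b; lia.
  rewrite /F (@iter_pdelta_const _ p.-1) ?size_gX -?Nb // coefC eqxx Nb.
  have -> : (g ^+ (N - b))`_(N - b).*2 = 1.
    have := monicP (rpredX (N - b) g_monic).
    by rewrite lead_coefE size_gX.
  by rewrite -Nb (natf_fact_neq0 k_char) //; lia.
apply/eqP; rewrite -subr_eq0; apply/eqP.
apply: (@dehom_homog_inj k two_neq0 N).
  rewrite rpredB ?iter_Delta_homog ?exp1_homog ?x1_homog //.
  apply: rpred_sum => i _; rewrite rpredZ //.
  have hi : N = ((N - i.*2) + (2 * i))%N.
    by have := ltn_ord i; rewrite /N /b; lia.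
  have := dhomogM (exp1_homog (N - i.*2) x3_homog) (dhomogMn i a2_homog).
  by rewrite -hi.
rewrite dehomB dehom_iter_Delta rmorphXn /= dehom_x1E.
pose t i := dehom (e i *: (a1 k ^+ (N - i.*2) * a2 k ^+ i)).
rewrite rmorph_sum /= (big_ord_widen N.+1 t) //.
have -> : dehom_x1 k = h%:P%:P * (map_poly polyC g - 'X%:P).
  by rewrite /dehom_x1 /g rmorphB /= map_polyXn map_polyX.
rewrite exprMn exprDn -polyC_exp -polyC_exp mul_polyC iter_pdeltaZ iter_pdelta_sum.
rewrite -mul_polyC mulr_sumr [X in _ - X]big_mkcond /= -sumrB big1 // => i _.
have -> : map_poly polyC g ^+ (N - i) * (- 'X%:P) ^+ i *+ 'C(N, i) =
    (((-1) ^+ i * 'C(N, i)%:R)%:P * 'X ^+ i) *: map_poly polyC (g ^+ (N - i)).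
  rewrite -mul_polyC !polyCM !polyC_exp rmorphXn /= !polyC_natr !polyCN !polyC1.
  by rewrite -[X in X = _]mulr_natr exprNn; ring.
rewrite iter_pdeltaZ -map_iter_pdelta -/(F i) FC map_polyC /=.
case: ifP => ib.
  rewrite /t dehomZ dehomM !dehomXn dehom_a1 (dehom_a2 two_neq0).
  by rewrite /e -mul_polyC !polyCM expr1n !polyC_exp; ring.
(* Beyond [b] the degree [2(N - i)] is below [p - 1], so the coefficient of index [p - 1] is
   zero. *)
have sN : ((N - i).*2.+1 <= p.-1)%N.
  have : (b < i)%N by rewrite ltnNge -ltnS ib.
  by rewrite /N /b; move: (nat_of_ord i) => j; lia.
have -> : F i = 0.
  rewrite /F (@iter_pdelta_const _ p.-1) ?size_gX ?(leqW sN) //.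
  by rewrite nth_default ?mul0rn ?polyC0 // size_gX.
by rewrite coef0 !polyC0 scaler0 mulr0 subrr.
Qed.

End TransferX1.

(** * The subalgebra [A] *)

Local Notation Q := transfer_P0.
Local Notation inA := (inA rG s p).
Local Notation a := [tuple a1 k; a2 k; a3 rG s p].

Lemma inA1 : inA 1. Proof. by exists 1; rewrite rmorph1. Qed.

Lemma inAC c : inA c%:MP. Proof. by exists c%:MP; rewrite comp_mpolyC. Qed.

Lemma inAM c c' : inA c -> inA c' -> inA (c * c').
Proof. by move=> [q ->] [q' ->]; exists (q * q'); rewrite rmorphM. Qed.

Lemma inAD c c' : inA c -> inA c' -> inA (c + c').
Proof. by move=> [q ->] [q' ->]; exists (q + q'); rewrite rmorphD. Qed.

Lemma inAX c i : inA c -> inA (c ^+ i).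
Proof. by move=> [q ->]; exists (q ^+ i); rewrite rmorphXn. Qed.

Lemma inA_gen (i : 'I_3) : inA a`_i.
Proof. by exists 'X_i; rewrite comp_mpolyXU. Qed.

Lemma inA_a1 : inA (a1 k). Proof. exact: (inA_gen (Ordinal (isT : (0 < 3)%N))). Qed.
Lemma inA_a2 : inA (a2 k). Proof. exact: (inA_gen (Ordinal (isT : (1 < 3)%N))). Qed.
Lemma inA_a3 : inA (a3 rG s p).
Proof. exact: (inA_gen (Ordinal (isT : (2 < 3)%N))). Qed.

Lemma inA_Delta c : inA c -> D c = 0.
Proof.
move=> [q ->]; apply/eqP; rewrite /Delta subr_eq0; apply/eqP.
apply: (@rmorph_mpoly_ext 3 k _ (act rG s \o comp_mpoly a) (comp_mpoly a)) => [c'|i] /=.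
  by rewrite comp_mpolyC actC.
rewrite comp_mpolyXU; apply/subr0_eq.
case: i => [[|[|[|//]]] ?] /=; first exact: Delta_a1.
  exact: Delta_a2.
exact: Delta_a3.
Qed.

(** [a_1] and [a_2] become constant in [y], so an element of [A] becomes a polynomial over
    [k[alpha]] evaluated at the image of [a_3], which has degree [2p]. *)
Lemma dehom_inA c : inA c -> exists i, (size (dehom c)).-1 = (i * p.*2)%N.
Proof.
move=> [q ->]; pose h : {mpoly k[3]} -> {poly {poly k}} :=
  mmap (polyC \o polyC) (fun i : 'I_3 => [:: 1; 'X%:P; 'X]`_i).
have -> : dehom (q \mPo a) = h q \Po dehom (a3 rG s p).
  apply: (@rmorph_mpoly_ext 3 k _ (@dehom k \o comp_mpoly a)
    (comp_poly (dehom (a3 rG s p)) \o mmap _ _)) => [c'|i] /=.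
    by rewrite comp_mpolyC dehomC mmapC comp_polyC.
  rewrite comp_mpolyXU mmapX mmap1U.
  case: i => [[|[|[|//]]] ?] /=; first by rewrite dehom_a1 comp_polyC.
    by rewrite (dehom_a2 two_neq0) comp_polyC.
  by rewrite comp_polyX.
exists (size (h q)).-1.
by rewrite size_comp_poly dehom_a3_size.
Qed.

(** * The [A]-span of [T_n] *)

Section Level.
Variable n : nat.
Hypothesis n_lt_p : (n < p)%N.
Local Notation T := (T rG s p n).
Local Notation span := (module_span inA T).
Local Notation r := (uphalf n).

(** The transfer of [P_(2l+1)], indexed by the exponent of [a_1] in its lowest term. *)
Definition transfer_x1_pow l := iter p.-1 D (x1 k ^+ (p.-1 - l)).

Lemma P_odd l : P k p l.*2.+1 = x1 k ^+ (p.-1 - l).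
Proof. by rewrite /P /= doubleK; congr (_ ^+ _); lia. Qed.

Lemma T_transfer_x1_pow l : (l < r)%N -> T (transfer_x1_pow l).
Proof.
move=> lr; right; exists l.*2.+1; split; rewrite ?P_odd //; first lia.
by left; rewrite /= odd_double.
Qed.

Lemma TP f : T f ->
  [\/ f = iter n D (M k n), f = Q | exists2 l, (l < r)%N & f = transfer_x1_pow l].
Proof.
case=> [->|[i [ilt [oi|->] ->]]]; [by constructor 1| |by constructor 2].
constructor 3; exists i./2; first by have := odd_double_half i; lia.
by rewrite /transfer_x1_pow -P_odd -[in LHS](odd_double_half i) oi.
Qed.

Lemma r_le_m : (r <= m)%N.
Proof. by have := p_double; lia. Qed.

(* For [l < r], the transfer of [x_1^(p-1-l)] rewrites [a_1^l a_2^j] in terms of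
   monomials with a smaller exponent of [a_2] that still satisfy [m <= l + j]. *)
Lemma span_a1_a2 l j : (r <= l)%N || (m <= l + j)%N -> span (a1 k ^+ l * a2 k ^+ j).
Proof.
have scal c f : span f -> span (c *: f).
  by rewrite -mul_mpolyC; apply: module_spanM (inAC c); apply: inAM.
elim/ltn_ind: j l => j IHj l; have [rl _|lr /= mlj] := leqP r l.
  have [u u0 uE] := iter_Delta_M n_lt_p.
  have a1r : a1 k ^+ r = u^-1 *: iter n D (M k n).
    by rewrite uE scalerA mulVf // scale1r.
  rewrite -(subnK rl) exprD mulrAC a1r -scalerAr; apply: (scal).
  apply: module_spanM; first exact: inAM.
    by apply: inAM; apply: inAX; [exact: inA_a1|exact: inA_a2].
  by apply: module_span_gen; [exact: inA1|left].
have lm : (l < m)%N := leq_trans lr r_le_m.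
have [e e0 eE] := transfer_x1 lm.
have pm := p_double; set b := (m - l)%N in e0 eE.
have bj : (b <= j)%N by rewrite /b; lia.
have Sg : span (a2 k ^+ (j - b) * transfer_x1_pow l).
  apply: module_spanM; [exact: inAM|by apply: inAX; exact: inA_a2|].
  by apply: module_span_gen; [exact: inA1|exact: T_transfer_x1_pow].
have top : a2 k ^+ (j - b) * transfer_x1_pow l - e b *: (a1 k ^+ l * a2 k ^+ j) =
    \sum_(i < b) e i *: (a1 k ^+ (p.-1 - l - i.*2) * a2 k ^+ (j - b + i)).
  rewrite /transfer_x1_pow eE big_ord_recr /= mulrDr.
  rewrite (_ : p.-1 - l - b.*2 = l)%N; last by rewrite /b; lia.
  rewrite -scalerAr mulrCA -exprD subnK // addrK mulr_sumr.
  by apply: eq_bigr => i _; rewrite -scalerAr mulrCA -exprD.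
rewrite -[X in span X]scale1r -(mulVf e0) -scalerA; apply: (scal).
rewrite -[X in span X](subKr (a2 k ^+ (j - b) * transfer_x1_pow l)) top -scaleN1r.
apply: module_spanD => //; apply: (scal); apply: module_span_sum => i _; apply: (scal).
(* The new exponents of [a_1] and [a_2] add up to [m + j - i], which is at least [m] because
   [i < b <= j]. *)
have ib := ltn_ord i; apply: IHj; first by lia.
by apply/orP; right; move: ib; rewrite /b; move: (nat_of_ord i) => i'; lia.
Qed.

Definition family d (x : 'I_d.+2 * 'I_d.+1) : {mpoly k[3]} :=
  a1 k ^+ (d - x.2.*2 - p * uphalf x.1) * a2 k ^+ x.2 *
  (a3 rG s p ^+ x.1./2 * Q ^+ odd x.1).

Lemma span_family d x : family_pred p d n x -> span (family x).
Proof.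
move=> /andP[_ xP]; rewrite /family.
have [ox|ex] := boolP (odd x.1).
  rewrite expr1 mulrA; apply: module_spanM; first exact: inAM.
    by do !apply: inAM; apply: inAX; [exact: inA_a1|exact: inA_a2|exact: inA_a3].
  by apply: module_span_gen; [exact: inA1|right; exists 0%N; split=> //; right].
rewrite expr0 mulr1 mulrC; apply: module_spanM; first exact: inAM.
  by apply: inAX; exact: inA_a3.
move: xP; rewrite (negPf ex) /= => xP; apply: span_a1_a2.
by case/orP: xP => xP; apply/orP; [left|right; lia].
Qed.

Lemma T_IG f : T f -> D f = 0 /\ imDelta rG s n f.
Proof.
have im h : imDelta rG s n (iter p.-1 D h).
  by exists (iter (p.-1 - n) D h); rewrite -iterD subnKC //; lia.
case=> [->|[i [_ _ ->]]]; split=> //.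
- have [u _ ->] := iter_Delta_M n_lt_p.
  by rewrite linearZ /= DeltaX_eq0 ?scaler0 // Delta_a1.
- by exists (M k n).
- exact: Delta_transfer.
Qed.

Lemma span_IG f : span f -> D f = 0 /\ imDelta rG s n f.
Proof.
apply: (@module_span_ind _ _ _ (fun f => D f = 0 /\ imDelta rG s n f))
  => [|g h [Dg [g' gE]] [Dh [h' hE]]|c b Ac /T_IG[Db [b' bE]]].
- by split; [|exists 0]; rewrite linear0.
- split; first by rewrite (linearD D) /= Dg Dh addr0.
  by exists (g' + h'); rewrite gE hE (linearD (iter n D)).
- have Dc := inA_Delta Ac; split; first exact: DeltaM_eq0.
  by exists (c * b'); rewrite iter_Delta_mull // bE.
Qed.

End Level.

(** * Linear independence of the family *)

Definition cofactor_gen e := a3 rG s p ^+ e./2 * Q ^+ odd e.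

Lemma size_cofactor_gen e : size (dehom (cofactor_gen e)) = (p * e).+1.
Proof.
have sa := dehom_a3_size.
have sQ := transfer_P0_size.
have a0 : dehom (a3 rG s p) != 0 by rewrite -size_poly_gt0 sa.
have Q0 : dehom Q != 0 by rewrite -size_poly_gt0 sQ.
have Qe0 : dehom (Q ^+ odd e) != 0 by rewrite dehomXn expf_neq0.
rewrite /cofactor_gen dehomM size_mul ?dehomXn ?expf_neq0 //.
rewrite -[size (dehom (a3 rG s p) ^+ e./2)]prednK ?size_poly_gt0 ?expf_neq0 //.
rewrite size_exp sa /=.
have -> : size (dehom Q ^+ odd e) = (p * odd e).+1.
  by case: (odd e); rewrite ?expr0 ?muln0 ?size_poly1 // expr1 muln1.
have := odd_double_half e; move: (odd e) (e./2) => o h <-; clear; nia.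
Qed.

Lemma family_homog d (x : 'I_d.+2 * 'I_d.+1) :
  (x.2.*2 + p * uphalf x.1 <= d)%N -> family x \is d.-homog.
Proof.
move=> xd; rewrite /family.
have dE : ((d - x.2.*2 - p * uphalf x.1) + 2 * x.2 +
    (p * x.1./2 + p * odd x.1) = d)%N.
  rewrite addnC -mulnDr [(_ + odd _)%N]addnC -uphalf_half.
  by move: (p * _)%N (nat_of_ord x.2) xd => w j; lia.
rewrite -[X in _ \is X.-homog]dE !dhomogM ?dhomogMn ?exp1_homog ?x3_homog ?a2_homog //.
  exact: a3_homog.
exact: transfer_P0_homog.
Qed.

Lemma dehom_family d (x : 'I_d.+2 * 'I_d.+1) :
  dehom (family x) = 'X^(x.2) *: dehom (cofactor_gen x.1).
Proof.
rewrite /family 2!dehomM !dehomXn dehom_a1 expr1n mul1r.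
by rewrite (dehom_a2 two_neq0) -polyC_exp mul_polyC.
Qed.

Lemma family_free d (B : pred ('I_d.+2 * 'I_d.+1)) (c : 'I_d.+2 * 'I_d.+1 -> k) :
  \sum_(x in B) c x *: family x = 0 -> forall x, x \in B -> c x = 0.
Proof.
move=> sum0 [e j] xB; pose c' x := if x \in B then c x else 0.
(* Terms are grouped by [e]: [q e] is the polynomial in [alpha] multiplying [cofactor_gen e], and
   these cofactors have distinct degrees in [y]. *)
pose q i := \sum_(l < d.+1) c' (inord i, l) *: 'X^l : {poly k}.
have : \sum_(i < d.+2) q i *: dehom (cofactor_gen i) = 0.
  have := congr1 (@dehom k) sum0; rewrite rmorph_sum rmorph0 /= big_mkcond /= => S0.
  rewrite -[RHS]S0.
  have qE (i : 'I_d.+2) : q i *: dehom (cofactor_gen i) =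
      \sum_(l < d.+1) (c' (i, l))%:P%:P * ('X^l *: dehom (cofactor_gen i)).
    rewrite scaler_suml; apply: eq_bigr => l _.
    by rewrite inord_val mul_polyC scalerA mul_polyC.
  rewrite (eq_bigr _ (fun i _ => qE i)) pair_bigA; apply: eq_bigr => x _ /=.
  rewrite /c' -surjective_pairing.
  by case: ifP => _; rewrite ?polyC0 ?mul0r // dehomZ dehom_family.
move/(@distinct_size_free _ _ (fun i => dehom (cofactor_gen i))) => q0.
have : q e = 0.
  apply: q0 => // [i i' ii'|i]; last by rewrite -size_poly_gt0 size_cofactor_gen.
  by rewrite !size_cofactor_gen ltnS ltn_pmul2l // (ltnW (ltnW p_gt2)).
move/(congr1 (coefp j)); rewrite /= coef0 coef_sum (bigD1 j) //= coefZ coefXn eqxx.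
rewrite mulr1 big1 ?addr0 => [|l lj]; first by rewrite /c' inord_val xB.
by rewrite coefZ coefXn eq_sym (inj_eq val_inj) (negPf lj) mulr0.
Qed.

(** * Generation by a dimension count *)

Section Graded.
Variable d : nat.
Local Notation V := (dhomog 3 k d).

Definition Delta_dhomog (v : V) : V :=
  DHomog (iter_Delta_homog rG s 1 (dhomog_is_dhomog v)).

Lemma Delta_dhomog_is_linear : linear Delta_dhomog.
Proof. by move=> c u v; apply: val_inj; rewrite /= !linearP. Qed.
HB.instance Definition _ :=
  GRing.isLinear.Build k V V _ Delta_dhomog Delta_dhomog_is_linear.

Lemma val_iter_Delta_dhomog i (v : V) :
  val (iter i (linfun Delta_dhomog) v) = iter i D (val v).
Proof. by elim: i => //= i <-; rewrite lfunE. Qed.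

End Graded.

(** All levels [i < p] are treated at once: only the sum of their dimensions is known, and the lower
    bounds given by the family already exhaust it. *)
Lemma homog_IG_span n d f : (n < p)%N -> f \is d.-homog ->
  D f = 0 -> imDelta rG s n f -> module_span inA (T rG s p n) f.
Proof.
move=> np hf Df [h fE]; pose F := linfun (@Delta_dhomog d).
pose fam (x : 'I_d.+2 * 'I_d.+1) : dhomog 3 k d := indhomog d (family x).
have famE i x : x \in family_pred p d i -> val (fam x) = family x.
  by case/andP => xd _; rewrite /fam /indhomog insubdK //; exact: family_homog.
pose L (i : 'I_p) := <<[seq fam x | x <- enum (family_pred p d i)]>>%VS.
have dimL i : \dim (L i) = #|family_pred p d i|.
  apply: dim_span_family => c sum0; apply: family_free.
  have := congr1 val sum0; rewrite raddf_sum /= => S0; rewrite -[RHS]S0.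
  by apply: eq_bigr => x xP; rewrite (famE _ _ xP).
have val0 (v : dhomog 3 k d) : val v = 0 -> v = 0 by move=> v0; apply: val_inj.
have LI : forall i, L i = (iter_img F i :&: lker F)%VS.
  apply: nilpotent_filtration_eq => [i||].
  - apply/span_subvP => v /mapP[x]; rewrite mem_enum => xP ->.
    have [Dx [g gE]] := span_IG (ltn_ord i) (span_family (ltn_ord i) xP).
    rewrite memv_cap; apply/andP; split.
      (* The degree [d] part of a preimage is again a preimage. *)
      apply/iter_imgP; exists (DHomog (pihomogP mdeg d g)); apply: val_inj.
      rewrite val_iter_Delta_dhomog (famE _ _ xP) /= -pihomog_iter_Delta -gE.
      by rewrite pihomog_dE // family_homog //; case/andP: xP.
    by rewrite memv_ker lfunE; apply/eqP/val0; rewrite /= (famE _ _ xP).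
  - apply/eqP; rewrite -subv0; apply/subvP => v /iter_imgP[w ->].
    rewrite memv0; apply/eqP/val0; rewrite val_iter_Delta_dhomog.
    exact: Delta_p.
  - rewrite dimvf (eq_bigr _ (fun i _ => dimL i)) sum_card_family //.
      have -> : dim (dhomog 3 k d) = 'C(d + 2, d) by [].
      by rewrite -bin_sub ?leq_addr // addKn addn2.
    exact: ltnW p_gt2.
have : DHomog hf \in L (Ordinal np).
  rewrite LI memv_cap; apply/andP; split.
    apply/iter_imgP; exists (DHomog (pihomogP mdeg d h)); apply: val_inj.
    by rewrite val_iter_Delta_dhomog /= -pihomog_iter_Delta -fE pihomog_dE.
  by rewrite memv_ker lfunE; apply/eqP/val0.
rewrite /L => /(@coord_span _ _ _ (in_tuple _)) /(congr1 val) /= ->.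
rewrite raddf_sum; apply: module_span_sum => i _ /=; rewrite -mul_mpolyC.
apply: module_spanM (inAC _) _; first exact: inAM.
have /mapP[x] := mem_nth 0 (ltn_ord i); rewrite mem_enum => xP /= ->.
by rewrite (famE _ _ xP); apply: span_family.
Qed.

Lemma T_generates n : (n < p)%N -> generates inA (T rG s p n) (IG rG s n).
Proof.
move=> np f; split=> [[/invariantP Df [h fE]]|/(span_IG np)[Df imf]]; last first.
  by split=> //; apply/invariantP.
rewrite (pihomog_partitionE (leqnn (mmeasure mdeg f))).
apply: module_span_sum => d _; apply: homog_IG_span => //.
- exact: pihomogP.
- by have /= <- := pihomog_iter_Delta rG s 1 d f; rewrite Df linear0.
- by exists (pihomog mdeg d h); rewrite -pihomog_iter_Delta -fE.
Qed.

(** * Monomials that single out the transfers *)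

Lemma transfer_x1_pow_homog l : transfer_x1_pow l \is (p.-1 - l).-homog.
Proof. by rewrite iter_Delta_homog // exp1_homog // x1_homog. Qed.

Lemma a2_exp b : exists w, a2 k ^+ b = x2 k ^+ b.*2 + w * x3 k.
Proof.
elim: b => [|b [w IHb]]; first by exists 0; rewrite mul0r addr0 !expr0.
exists (a2 k * w - (2%:R * x1 k + x2 k) * x2 k ^+ b.*2).
by rewrite exprS IHb doubleS !exprS /a2; ring.
Qed.

(** Modulo [x_3^(l+1)] only the summand [i = m - l] of [transfer_x1] survives, since the others
    carry [a_1] to a power above [l], and [a_2] is [x_2^2] modulo [x_3]. *)
Lemma transfer_x1_pow_lead l : (l < m)%N -> exists u w,
  u != 0 /\ transfer_x1_pow l = u *: (x2 k ^+ (m - l).*2 * x3 k ^+ l) + w * x3 k ^+ l.+1.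
Proof.
move=> lm; have [e e0 eE] := transfer_x1 lm.
have pm := p_double; have [w wE] := a2_exp (m - l).
exists (e (m - l)%N), (e (m - l)%N *: w + \sum_(i < m - l)
  e i *: (a1 k ^+ (p.-1 - l - i.*2 - l.+1) * a2 k ^+ i)).
split=> //; rewrite /transfer_x1_pow eE big_ord_recr /= addrC wE.
rewrite (_ : p.-1 - l - (m - l).*2 = l)%N; last by lia.
rewrite mulrDl addrA; congr (_ + _).
  by rewrite -scalerAl -scalerDr /a1 exprS; congr (_ *: _); ring.
rewrite mulr_suml; apply: eq_bigr => i _; rewrite -scalerAl mulrAC -exprD subnK //.
by have := ltn_ord i; lia.
Qed.

(* The monomial [x_2^(2(m-l)) x_3^l] occurs in the transfer of [x_1^(p-1-l)], but
   in no multiple of another element of [T_n]. *)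
Let mu l : 'X_{1..3} := (U_(Ordinal (isT : (1 < 3)%N)) *+ (m - l).*2 +
  U_(Ordinal (isT : (2 < 3)%N)) *+ l)%MM.

Lemma transfer_x1_pow_mcoeff l : (l < m)%N -> (transfer_x1_pow l)@_(mu l) != 0.
Proof.
move=> lm; have [u [w [u0 ->]]] := transfer_x1_pow_lead lm.
rewrite mcoeffD mcoeff_mul_Xn ?addr0; last first.
  by rewrite mnmDE !mulmnE !mnm1E /=; lia.
by rewrite mcoeffZ /x2 /x3 !mpolyXn -mpolyXD mcoeffX eqxx mulr1.
Qed.

(** * Minimality *)

Section Minimality.
Variables (n : nat) (S' : {mpoly k[3]} -> Prop).
Hypotheses (n_lt_p : (n < p)%N) (S'T : forall f, S' f -> T rG s p n f).
Local Notation span := (module_span inA S').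

Lemma mdeg_mu l : (l < m)%N -> mdeg (mu l) = (p.-1 - l)%N.
Proof. by move=> lm; rewrite mdegD !mdegMn !mdeg1; have := p_double; lia. Qed.

(** The monomial [mu l] has too small an exponent of [x_3] for multiples of [Delta^n (M_n)] and of
    the transfers with [l' > l], and too small a degree for multiples of [Q] and of those with
    [l' < l]. *)
Lemma transfer_x1_pow_essential l : (l < uphalf n)%N ->
  ~ S' (transfer_x1_pow l) -> ~ span (transfer_x1_pow l).
Proof.
move=> lr Sl spl; have lm := leq_trans lr (r_le_m n_lt_p).
have pm := p_double; have := transfer_x1_pow_mcoeff lm; apply/negP; rewrite negbK.
apply/eqP; apply: (@module_span_ind _ _ _ (fun f => f@_(mu l) = 0)) spl.
- exact: mcoeff0.
- by move=> g h g0 h0; rewrite mcoeffD g0 h0 addr0.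
move=> c b _ Sb; case: (TP n_lt_p (S'T Sb)) => [bE|bE|[l' l'r bE]].
- have [u _ uE] := iter_Delta_M n_lt_p.
  rewrite bE uE -scalerAr mcoeffZ mcoeff_mul_Xn ?mulr0 //.
  by rewrite mnmDE !mulmnE !mnm1E /=; lia.
- rewrite bE (mcoeff_mul_homog _ transfer_P0_homog) //.
  by rewrite mdeg_mu //; lia.
have l'm := leq_trans l'r (r_le_m n_lt_p).
have [ll'|l'l|ll'] := ltngtP l l'; last by case: Sl; rewrite ll' -bE.
- have [u [w [_ wE]]] := transfer_x1_pow_lead l'm.
  rewrite bE wE exprS [w * _]mulrA scalerAl -mulrDl mulrA mcoeff_mul_Xn //.
  by rewrite mnmDE !mulmnE !mnm1E /=; lia.
- rewrite bE (mcoeff_mul_homog _ (transfer_x1_pow_homog l')) //.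
  by rewrite mdeg_mu //; lia.
Qed.

(** This generator has degree [uphalf n <= m], while all the others have degree above [m]. *)
Lemma iter_Delta_M_essential :
  ~ S' (iter n D (M k n)) -> ~ span (iter n D (M k n)).
Proof.
move=> Sl spl; have pm := p_double.
have [u u0 uE] := iter_Delta_M n_lt_p.
pose nu : 'X_{1..3} := (U_(Ordinal (isT : (2 < 3)%N)) *+ uphalf n)%MM.
have degnu : mdeg nu = uphalf n by rewrite mdegMn mdeg1 mul1n.
have : (iter n D (M k n))@_nu != 0.
  by rewrite uE mcoeffZ /a1 /x3 mpolyXn mcoeffX eqxx mulr1.
apply/negP; rewrite negbK; apply/eqP.
apply: (@module_span_ind _ _ _ (fun f => f@_nu = 0)) spl.
- exact: mcoeff0.
- by move=> g h g0 h0; rewrite mcoeffD g0 h0 addr0.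
move=> c b _ Sb; case: (TP n_lt_p (S'T Sb)) => [bE|bE|[l' l'r bE]].
- by case: Sl; rewrite -bE.
- rewrite bE (mcoeff_mul_homog _ transfer_P0_homog) //.
  by rewrite degnu; lia.
- rewrite bE (mcoeff_mul_homog _ (transfer_x1_pow_homog l')) //.
  by rewrite degnu; lia.
Qed.

(** All other generators lie in [A], so [Q] would too; its degree [p] in [y] would be a multiple of
    [2p], although [p] is odd. *)
Lemma transfer_P0_essential : ~ S' Q -> ~ span Q.
Proof.
move=> SQ spQ; have /dehom_inA[i] : inA Q.
  apply: (@module_span_ind _ _ _ inA) spQ.
  - by exists 0; rewrite rmorph0.
  - by move=> g h; apply: inAD.
  move=> c b Ac Sb; apply: inAM Ac _; case: (TP n_lt_p (S'T Sb)) => [bE|bE|[l' l'r bE]].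
  - have [u _ uE] := iter_Delta_M n_lt_p.
    by rewrite bE uE -mul_mpolyC; apply: inAM (inAC _) (inAX _ inA_a1).
  - by case: SQ; rewrite -bE.
  have [e _ eE] := transfer_x1
    (leq_trans l'r (r_le_m n_lt_p)).
  rewrite bE /transfer_x1_pow eE; elim/big_rec: _ => [|j g _ Ag].
    by exists 0; rewrite rmorph0.
  apply: inAD Ag; rewrite -mul_mpolyC; apply: inAM (inAC _) _.
  by apply: inAM; apply: inAX; [exact: inA_a1|exact: inA_a2].
rewrite transfer_P0_size /= => pE.
by have := congr1 odd pE; rewrite p_odd oddM odd_double andbF.
Qed.

End Minimality.

End TransferGenerators.

Theorem mainTheorem4 (p : nat) (p_prime : prime p) (p_odd : odd p)
  (k : fieldType) (k_char : p \in [pchar k])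
  (gT : finGroupType) (s : gT) (s_order : #[s]%g = p)
  (rG : mx_representation k <[s]> 3) (rG_sigma : rG s = jordan3 k)
  (n : nat) (n_bounds : (1 <= n <= p)%N) :
  minimal_generating_set (inA rG s p) (T rG s p n.-1) (IG rG s n.-1).
Proof.
have np : (n.-1 < p)%N by lia.
have genT := T_generates p_odd k_char s_order rG_sigma np.
split=> // S' [S'T [f [Tf S'f]]] gen'.
(* An omitted generator [f] would be an [A]-combination of the remaining ones, which fails for each
   of the three kinds. *)
have spf : module_span (inA rG s p) S' f.
  by apply/gen'/genT; apply: module_span_gen => //; apply: inA1.
case: (TP p_odd k_char s_order np Tf) => [fE|fE|[l lr fE]]; rewrite fE in S'f spf.
- exact: (iter_Delta_M_essential p_odd k_char s_order rG_sigma np S'T S'f spf).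
- exact: (transfer_P0_essential p_odd k_char s_order rG_sigma np S'T S'f spf).
- exact: (transfer_x1_pow_essential p_odd k_char s_order rG_sigma np S'T lr S'f spf).
Qed.
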